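(* Let $N\ge2$, let $\rho=(S_i)_{i=0,\dots,N-1}$ be a representation of the Cuntz algebra $\mathcal O_N$ on a separable Hilbert space $H$, and let $v_0\in H$ satisfy $\|v_0\|=1$ and $S_0v_0=v_0$. The following statements are equivalent: (i) the family $\{S_\omega v_0:\ \omega \text{ a finite word over } \{0,1,\dots,N-1\}\}$ (with repeats removed) is an orthonormal basis of $H$; (ii) the representation $\rho$ is irreducible.
   Context: A representation of the Cuntz algebra $\mathcal O_N$ on $H$ is a family of bounded operators $S_0,\dots,S_{N-1}$ on $H$ with $S_i^*S_j=\delta_{i,j}I$ for all $i,j$ and $\sum_{i=0}^{N-1}S_iS_i^*=I$. It is irreducible if the only closed subspaces of $H$ invariant under all $S_i$ and all $S_i^*$ are $\{0\}$ and $H$. For a word $\omega=\omega_1\cdots\omega_n$, $S_\omega=S_{\omega_1}\cdots S_{\omega_n}$ (with $S_\emptyset=I$ for the empty word). ''With repeats removed'' means the family is considered as a set of vectors, each distinct vector occurring once. *)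

(* Defs.v *)
From HB Require Import structures.
From mathcomp Require Import all_boot all_order all_algebra.
From mathcomp Require Import all_classical all_reals all_analysis.
From mathcomp Require Import complex.
Import numFieldNormedType.Exports.
Import Order.TTheory GRing.Theory Num.Theory.

Set Implicit Arguments.
Unset Strict Implicit.
Unset Printing Implicit Defensive.

Local Open Scope classical_set_scope.
Local Open Scope ring_scope.
Local Open Scope complex_scope.

(* A complex Hilbert space is a complete normed module H over R[i] together
   with a positive definite hermitian form inducing its norm. The form is linear
   in its first argument and conjugate-linear in the second one. *)
Definition induces_norm (R : realType) (H : completeNormedModType R[i])
    (dot : {dot H for Num.conj}) : Prop :=
  forall x : H, `|x| ^+ 2 = dot x x.

Definition separable (T : topologicalType) : Prop :=
  exists2 D : set T, countable D & dense D.

Definition bounded_operator (R : realType) (H : completeNormedModType R[i])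
    (T : H -> H) : Prop :=
  exists M : R[i], forall x : H, `|T x| <= M * `|x|.

(* T^* y is the unique z with <T x, y> = <x, z> for all x. For a bounded linear
   T it exists by the Riesz representation theorem; the default value 0 is then
   never used. *)
Definition adjoint (R : realType) (H : completeNormedModType R[i])
    (dot : {dot H for Num.conj}) (T : H -> H) (y : H) : H :=
  xget 0 [set z : H | forall x : H, dot (T x) y = dot x z].

Definition cuntz_representation (R : realType) (H : completeNormedModType R[i])
    (dot : {dot H for Num.conj}) (N : nat) (S : 'I_N -> {linear H -> H}) : Prop :=
  [/\ forall i : 'I_N, bounded_operator (S i),
      forall (i j : 'I_N) (x : H),
        adjoint dot (S i) (S j x) = (i == j)%:R *: x
    & forall x : H, \sum_(i < N) S i (adjoint dot (S i) x) = x].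

Definition irreducible_representation (R : realType)
    (H : completeNormedModType R[i]) (dot : {dot H for Num.conj})
    (N : nat) (S : 'I_N -> {linear H -> H}) : Prop :=
  forall K : set H,
    closed K -> submod_closed [in K] ->
    (forall i : 'I_N, S i @` K `<=` K) ->
    (forall i : 'I_N, adjoint dot (S i) @` K `<=` K) ->
    K = [set 0] \/ K = setT.

(* S_w for w = [:: w1; ...; wn] is S_w1 \o ... \o S_wn. *)
Definition word_op (R : realType) (H : completeNormedModType R[i])
    (N : nat) (S : 'I_N -> {linear H -> H}) (w : seq 'I_N) : H -> H :=
  foldr (fun (i : 'I_N) (T : H -> H) => S i \o T) idfun w.

Definition linear_span (R : realType) (H : completeNormedModType R[i])
    (B : set H) : set H :=
  [set x | exists (n : nat) (c : 'I_n -> R[i]) (b : 'I_n -> H),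
     (forall k : 'I_n, B (b k)) /\ x = \sum_(k < n) c k *: b k].

Definition orthonormal_basis (R : realType) (H : completeNormedModType R[i])
    (dot : {dot H for Num.conj}) (B : set H) : Prop :=
  (forall u v : H, B u -> B v -> dot u v = (u == v)%:R)
  /\ closure (linear_span B) = setT.

(* Main.v *)
(* Orthonormality always holds: since v0 = S_0 v0, cancelling first letters shows
   that S_w v0 and S_u v0 are either equal or orthogonal. The closed span of these
   vectors is invariant under all S_i and S_i^*, so irreducibility makes it H.
   Conversely, if the span is dense, then (S_0^* )^n x tends to <x, v0> v0 for
   every x, because this holds, with equality for large n, on the vectors
   S_w v0. So a closed invariant K either is orthogonal to v0, hence to every
   S_w v0, and is 0, or contains v0, hence every S_w v0, and is H. *)
Require Import Defs.
From HB Require Import structures.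
From mathcomp Require Import all_boot all_order all_algebra.
From mathcomp Require Import all_classical all_reals all_analysis.
From mathcomp Require Import complex.
Import numFieldNormedType.Exports.
Import Order.TTheory GRing.Theory Num.Theory.
Local Open Scope classical_set_scope.
Local Open Scope ring_scope.
Local Open Scope complex_scope.

(** * Avoiding finitely many proper subspaces *)

Section GenericVector.
Set Implicit Arguments.
Unset Strict Implicit.
Context {F : numFieldType} {V : lmodType F}.
Implicit Types (D : set V) (s : seq (set V)).

Lemma submod_set0 D : submod_closed [in D] -> D 0.
Proof. by case=> D0 _; rewrite -inE. Qed.

Lemma submod_setP D a u v : submod_closed [in D] -> D u -> D v -> D (a *: u + v).
Proof. by case=> _ DP Du Dv; rewrite -inE; apply: DP; rewrite inE. Qed.

Lemma submod_setZ D a u : submod_closed [in D] -> D u -> D (a *: u).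
Proof.
by move=> sD Du; rewrite -[_ *: _]addr0; apply: submod_setP => //; exact: submod_set0.
Qed.

Lemma submod_setPP D a u v : submod_closed [in D] -> D u -> D (a *: u + v) -> D v.
Proof.
move=> sD Du Dv; have := submod_setP (- a) sD Du Dv.
by rewrite addrA -scalerDl addNr scale0r add0r.
Qed.

(* An affine line not contained in a subspace meets it in at most one point. *)
Lemma eventually_notin_submod D (y z : V) :
  submod_closed [in D] -> ~ D y ->
  exists n0 : nat, forall n, (n0 <= n)%N -> ~ D (n%:R *: y + z).
Proof.
move=> sD Dy; have [[c Dc]|nD] := pselect (exists c : nat, D (c%:R *: y + z)); last first.
  by exists 0%N => n _ Dn; apply: nD; exists n.
exists c.+1 => n cn Dn; apply: Dy.
have /(submod_setZ ((n - c)%:R^-1) sD) : D ((n - c)%:R *: y).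
  apply: (@submod_setPP _ 1 (c%:R *: y + z)) => //.
  by rewrite scale1r addrC addrA -scalerDl -natrD subnK// ltnW.
rewrite scalerA mulVf ?scale1r// pnatr_eq0 subn_eq0 -ltnNge//.
Qed.

(** Induction on [s]. If the vector [y] found for the tail lies in a proper [D], pick [z] outside
    [D]: no [n%:R *: y + z] lies in [D], and for large [n] these points also leave each tail
    subspace not containing [y]. Those containing [y] are the whole space. *)
Lemma generic_vector s :
  (forall D, D \in s -> submod_closed [in D]) ->
  exists y, forall D, D \in s -> D y -> D = setT.
Proof.
elim: s => [|D s IH] sub; first by exists 0.
have sD : submod_closed [in D] by apply: sub; rewrite mem_head.
have subs D' : D' \in s -> submod_closed [in D'].
  by move=> D's; apply: sub; rewrite inE D's orbT.
have [y gy] := IH subs.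
have [[Dy nT]|nDy] := pselect (D y /\ D <> setT); last first.
  exists y => D'; rewrite inE => /orP[/eqP->|/gy//] Dy.
  by apply: contrapT => nT; apply: nDy.
have [z nDz] : exists z, ~ D z.
  apply: contrapT => nz; apply: nT; apply/seteqP; split => // x _.
  by apply: contrapT => nx; apply: nz; exists x.
have [n0 n0P] : exists n0 : nat, forall n, (n0 <= n)%N ->
    forall D', D' \in s -> D' (n%:R *: y + z) -> D' = setT.
  elim: s gy subs {sub IH} => [|D' s IH] gy subs; first by exists 0%N.
  have [] := IH _ _.
  - by move=> E Es; apply: gy; rewrite inE Es orbT.
  - by move=> E Es; apply: subs; rewrite inE Es orbT.
  move=> n0 n0P; have [D'y|nD'y] := pselect (D' y).
    have D'T := gy _ (mem_head _ _) D'y.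
    by exists n0 => n n0n E; rewrite inE => /orP[/eqP->//|]; exact: n0P.
  have [n1 n1P] := @eventually_notin_submod D' y z (subs _ (mem_head _ _)) nD'y.
  exists (maxn n0 n1) => n; rewrite geq_max => /andP[n0n n1n] E.
  by rewrite inE => /orP[/eqP->/(n1P _ n1n)//|]; exact: n0P.
exists (n0%:R *: y + z) => D'; rewrite inE => /orP[/eqP->|/n0P]; last exact.
by move=> /(submod_setPP sD Dy).
Qed.

End GenericVector.

(** * Inner product, closures and linear spans *)

Section Hilbert.
Set Implicit Arguments.
Unset Strict Implicit.
Context {R : realType} {H : completeNormedModType R[i]} {dot : {dot H for Num.conj}}.
Hypothesis hdot : induces_norm dot.
Implicit Types (x y z : H) (A : set H).

Lemma dot_conj x y : dot x y = Num.conj (dot y x).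
Proof. by rewrite hermC expr0 mul1r. Qed.

Lemma dotr_inj x y : (forall z, dot z x = dot z y) -> x = y.
Proof.
move=> xy; apply/eqP; rewrite -subr_eq0 -(dnorm_eq0 dot).
by rewrite linearBr /= xy subrr.
Qed.

(** Split [x] into its projection [a *: y] and a rest [u] orthogonal to [y]; by Pythagoras, dropping
    [u] only decreases the norm. *)
Lemma dot_CauchySchwarz x y : `|dot x y| <= `|x| * `|y|.
Proof.
rewrite -(@ler_pXn2r _ 2)// ?nnegrE ?mulr_ge0// exprMn !hdot.
have [->|y0] := eqVneq y 0; first by rewrite !linear0r normr0 expr0n ?mulr0.
have yy : dot y y != 0 by rewrite dnorm_eq0.
pose a := dot x y / dot y y; pose u := x - a *: y.
have uy : dot u y = 0 by rewrite linearBl /= linearZl_LR /= divfK ?subrr.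
have -> : x = u + a *: y by rewrite subrK.
rewrite linearDl /= uy add0r linearZl_LR/= normrM (ger0_norm (dnorm_ge0 _ _)).
rewrite exprMn mulrA -dnormZ hnormDd/=; last by rewrite linearZr_LR/= uy mulr0.
by rewrite ler_wpM2r ?dnorm_ge0// lerDr dnorm_ge0.
Qed.

Lemma closure_normP A x :
  closure A x <-> forall e : R[i], 0 < e -> exists2 a, A a & `|x - a| < e.
Proof.
split=> [clA e e0|clA B].
  have [a [Aa xa]] := clA _ (nbhsx_ballx x e e0).
  by exists a => //; rewrite -ball_normE in xa.
rewrite -nbhs_ballE => -[e /= e0 eB]; have [a Aa xa] := clA _ e0.
by exists a; split => //; apply: eB; rewrite -ball_normE.
Qed.

(** Only subtractivity is asked of [f], so that it applies to the adjoints, which are bare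
    functions, as well as to the generators. *)
Lemma closure_contraction A (f : H -> H) :
  (forall x y, f (x - y) = f x - f y) -> (forall x, `|f x| <= `|x|) ->
  f @` A `<=` A -> f @` closure A `<=` closure A.
Proof.
move=> fB f1 fA _ [x /closure_normP clx <-]; apply/closure_normP => e e0.
have [a Aa xa] := clx _ e0; exists (f a); first by apply: fA; exists a.
by rewrite -fB (le_lt_trans (f1 _)).
Qed.

Lemma closure_submod A :
  submod_closed [in A] -> submod_closed [in closure A].
Proof.
move=> sA; split; first by rewrite inE; apply: subset_closure; exact: submod_set0.
move=> a u v; rewrite !inE => /closure_normP clu /closure_normP clv.
apply/closure_normP => e e0.
have [u' Au' uu'] : exists2 u', A u' & `|a *: (u - u')| < e / 2.
  have [-> |a0] := eqVneq a 0.
    by exists 0; rewrite ?scale0r ?normr0 ?divr_gt0//; exact: submod_set0.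
  have na : 0 < `|a| by rewrite normr_gt0.
  have [u' Au' uu'] := clu (e / 2 / `|a|) (divr_gt0 (divr_gt0 e0 (ltr0Sn _ _)) na).
  by exists u' => //; rewrite normrZ mulrC -ltr_pdivlMr.
have [v' Av' vv'] := clv _ (divr_gt0 e0 (ltr0Sn _ 1)).
exists (a *: u' + v'); first exact: submod_setP.
rewrite opprD addrACA -scalerBr [ltRHS]splitr.
by rewrite (le_lt_trans (ler_normD _ _))// ltrD.
Qed.

Lemma linear_span_submod A : submod_closed [in linear_span A].
Proof.
split; first by rewrite inE; exists 0%N, (fun=> 0), (fun=> 0); rewrite big_ord0; split => // -[].
move=> a u v; rewrite !inE => -[n [c [b [Ab ->]]]] [m [d [b' [Ab' ->]]]].
exists (n + m)%N, (fun k => match fintype.split k with inl i => a * c i | inr j => d j end),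
  (fun k => match fintype.split k with inl i => b i | inr j => b' j end).
split=> [k|]; first by case: fintype.split.
rewrite big_split_ord/= scaler_sumr; congr (_ + _); apply: eq_bigr => i _.
  by rewrite -[lshift _ _]/(unsplit (inl i)) unsplitK scalerA.
by rewrite -[rshift _ _]/(unsplit (inr i)) unsplitK.
Qed.

Lemma subset_linear_span A : A `<=` linear_span A.
Proof.
by move=> x Ax; exists 1%N, (fun=> 1), (fun=> x); rewrite big_ord1 scale1r.
Qed.

(** Serves as induction principle for spans, with [B] the set of vectors having the wanted
    property. *)
Lemma linear_span_min A B : submod_closed [in B] -> A `<=` B -> linear_span A `<=` B.
Proof.
move=> sB AB x [n [c [b [Ab ->]]]]; apply: big_ind => [|u v Bu Bv|i _].
- exact: submod_set0.
- by rewrite -[u]scale1r; apply: submod_setP.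
- by apply: submod_setZ => //; exact: AB.
Qed.

End Hilbert.

(** * Generators and their adjoints *)

Section Cuntz.
Set Implicit Arguments.
Unset Strict Implicit.
Context {R : realType} {H : completeNormedModType R[i]} {dot : {dot H for Num.conj}}.
Hypothesis hdot : induces_norm dot.
Context {N : nat} {S : 'I_N -> {linear H -> H}}.
Hypothesis hS : cuntz_representation dot S.
Implicit Types (i j : 'I_N) (x y z : H) (w u : seq 'I_N) (K : set H).

Local Notation A i := (adjoint dot (S i)).

Lemma adjoint_gen i j x : A i (S j x) = (i == j)%:R *: x.
Proof. by case: hS. Qed.

Lemma sum_gen_adjoint x : \sum_i S i (A i x) = x.
Proof. by case: hS. Qed.

(* Let D i be the subspace of those y at which the true adjoint of S i exists;
   outside D i the junk value of [adjoint] is 0. A y outside every proper D i is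
   thus a sum over the good indices k, those with D k = H, of vectors of
   S k H, so that these ranges add up to H. If i is bad, then S i x is orthogonal
   to every such range, hence S i x = 0 for all x, and D i = H after all. This
   avoids the Riesz theorem. *)
Lemma adjoint_exists i y : exists z, forall x, dot (S i x) y = dot x z.
Proof.
pose D j := [set y | exists z, forall x, dot (S j x) y = dot x z].
have subD j : submod_closed [in D j].
  split; first by rewrite inE; exists 0 => x; rewrite !linear0r.
  move=> a u v; rewrite !inE => -[u' uu'] [v' vv']; exists (a *: u' + v') => x.
  by rewrite !linearPr /= uu' vv'.
have D_adjoint j z : D j z -> forall x, dot (S j x) z = dot x (A j z).
  by move=> Dz; rewrite /adjoint; case: xgetP => [_ _ //|/(_ _) nD]; case: Dz => t /nD.
have not_D j z : ~ D j z -> A j z = 0.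
  move=> nDz; rewrite /adjoint; case: xgetP => // t _ tP.
  by case: nDz; exists t.
pose M := [set y | exists a : 'I_N -> H, y = \sum_(k | `[< D k = setT >]) S k (a k)].
have subM : submod_closed [in M].
  split; first by rewrite inE; exists (fun=> 0); rewrite big1// => k _; rewrite linear0.
  move=> a u v; rewrite !inE => -[f ->] [g ->]; exists (fun k => a *: f k + g k).
  by rewrite scaler_sumr -big_split/=; apply: eq_bigr => k _; rewrite linearP.
(* [M] joins the list so that one vector does both jobs: lying in no proper [D k] puts [g] in [M],
   and then [M] cannot be proper. *)
have [|g gP] := @generic_vector _ _ (M :: [seq D k | k <- enum 'I_N]).
  by move=> E; rewrite inE => /orP[/eqP->//|/mapP[k _ ->]].
have Mg : M g.
  exists (fun k => A k g); rewrite -[LHS]sum_gen_adjoint.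
  rewrite (bigID (fun k => `[< D k = setT >]))/= [X in _ + X]big1 ?addr0// => k.
  move=> /asboolPn nDT; rewrite not_D ?linear0// => Dg; apply: nDT.
  by apply: gP => //; rewrite inE map_f ?orbT// mem_enum.
have MT : M = setT by apply: gP; rewrite ?mem_head.
suff DT : D i = setT by have : D i y by rewrite DT.
apply: contrapT => bad.
have S0 x : S i x = 0.
  apply/eqP; rewrite -(dnorm_eq0 dot); apply/eqP.
  have [a Sx] : M (S i x) by rewrite MT.
  rewrite {1}Sx linear_sumlz big1// => k /asboolP Dk.
  rewrite /= D_adjoint ?Dk// adjoint_gen; case: eqP => [ki|_].
    by case: bad; rewrite -ki.
  by rewrite scale0r linear0r.
apply: bad; apply/seteqP; split => // z _; exists 0 => x.
by rewrite S0 linear0l linear0r.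
Qed.

Lemma dot_gen i x y : dot (S i x) y = dot x (A i y).
Proof.
rewrite /adjoint; case: xgetP => [//|nex].
by have [z /nex] := adjoint_exists i y.
Qed.

Lemma dot_gen_gen i j x y : dot (S i x) (S j y) = (i == j)%:R * dot x y.
Proof. by rewrite dot_gen adjoint_gen linearZr_LR /= rmorph_nat. Qed.

Lemma adjoint_linear i a x y : A i (a *: x + y) = a *: A i x + A i y.
Proof.
by apply: (@dotr_inj _ _ dot) => z; rewrite -dot_gen !linearPr /= !dot_gen.
Qed.

Lemma adjointB i x y : A i (x - y) = A i x - A i y.
Proof. by rewrite addrC -scaleN1r adjoint_linear scaleN1r addrC. Qed.

Lemma norm_gen i x : `|S i x| = `|x|.
Proof.
by apply/eqP; rewrite -(@eqrXn2 _ 2)// !hdot dot_gen_gen eqxx mul1r.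
Qed.

(** The square of the left side is [dot (S i (A i x)) x]; apply Cauchy-Schwarz, use that [S i] is
    isometric, and cancel one factor. *)
Lemma norm_adjoint_le i x : `|A i x| <= `|x|.
Proof.
have [->|Ax0] := eqVneq (A i x) 0; first by rewrite normr0.
rewrite -(@ler_pM2l _ `|A i x|) ?normr_gt0// -expr2 hdot -dot_gen.
rewrite -[X in X * _](norm_gen i).
rewrite (le_trans _ (dot_CauchySchwarz hdot _ _))// ger0_norm//.
by rewrite dot_gen dnorm_ge0.
Qed.

Lemma iter_adjoint_linear i n a x y :
  iter n (A i) (a *: x + y) = a *: iter n (A i) x + iter n (A i) y.
Proof. by elim: n => //= n ->; rewrite adjoint_linear. Qed.

Lemma norm_iter_adjoint_le i n x : `|iter n (A i) x| <= `|x|.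
Proof. by elim: n => //= n; apply: le_trans; exact: norm_adjoint_le. Qed.

Lemma norm_word w x : `|word_op S w x| = `|x|.
Proof. by elim: w => //= i w IH; rewrite norm_gen. Qed.

(** * The orbit of the fixed vector under words *)

Section FixedVector.
Context {i0 : 'I_N} {v0 : H}.
Hypotheses (hv0 : `|v0| = 1) (hfix : S i0 v0 = v0).

Local Notation W w := (word_op S w v0).
Local Notation B := [set word_op S w v0 | w in [set: seq 'I_N]].

(** Reading [v0] as [S i0 v0] provides a letter to cancel against [i]. *)
Lemma dot_word_cons i w : dot (W (i :: w)) v0 = (i == i0)%:R * dot (W w) v0.
Proof. by rewrite /= -{2}hfix dot_gen_gen. Qed.

Lemma dot_word_fix w : dot (W w) v0 = 0 \/ W w = v0.
Proof.
elim: w => [|i w IH]; first by right.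
rewrite dot_word_cons; case: eqP => [->|_]; rewrite ?mul0r; last by left.
by rewrite mul1r; case: IH => [|/= ->]; [left|right].
Qed.

(** Different first letters give orthogonal ranges and equal ones cancel; once a word runs out,
    [dot_word_fix] decides. *)
Lemma dot_word_word w u : dot (W w) (W u) = 0 \/ W w = W u.
Proof.
elim: w u => [|i w IH] u.
  case: (dot_word_fix u) => [u0|->]; last by right.
  by left; rewrite dot_conj u0 rmorph0.
case: u => [|j u]; first exact: dot_word_fix.
rewrite /= dot_gen_gen; case: eqP => [->|_]; rewrite ?mul0r; last by left.
by rewrite mul1r; case: (IH u) => [|->]; [left|right].
Qed.

(** Vectors are compared, not words: [w] and [rcons w i0] give the same vector. *)
Lemma word_orthonormal x y : B x -> B y -> dot x y = (x == y)%:R.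
Proof.
move=> [w _ <-] [u _ <-].
have Ww1 : dot (W w) (W w) = 1 by rewrite -hdot norm_word hv0 expr1n.
case: (dot_word_word w u) => [wu0|<-]; last by rewrite eqxx.
case: eqP => [wu|//]; move/eqP: Ww1.
by rewrite {2}wu wu0 eq_sym oner_eq0.
Qed.

(** Each application strips a first letter [i0], or gives [0] at any other letter. After the last
    letter [v0] remains, which the adjoint fixes. *)
Lemma iter_adjoint_word w : exists n0 : nat,
  forall n, (n0 <= n)%N -> iter n (A i0) (W w) = dot (W w) v0 *: v0.
Proof.
elim: w => [|i w [n0 n0P]].
  exists 0%N => n _; rewrite -hdot hv0 expr1n scale1r.
  by elim: n => //= n ->; rewrite -{1}hfix adjoint_gen eqxx scale1r.
exists n0.+1 => -[//|n] n0n; rewrite dot_word_cons iterSr /= adjoint_gen.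
(* A zero summand is added to fit the form [a *: x + y]; its iterates vanish by the norm bound. *)
rewrite -[_ *: W w]addr0 iter_adjoint_linear n0P// eq_sym scalerA.
suff -> : iter n (A i0) 0 = 0 by rewrite addr0.
by apply/eqP; rewrite -normr_le0 -[leRHS](@normr0 _ H) norm_iter_adjoint_le.
Qed.

Lemma iter_adjoint_span x : linear_span B x -> exists n0 : nat,
  forall n, (n0 <= n)%N -> iter n (A i0) x = dot x v0 *: v0.
Proof.
move: x; apply: linear_span_min => [|_ [w _ <-]]; last exact: iter_adjoint_word.
split.
  rewrite inE; exists 0%N => n _; rewrite linear0l scale0r.
  by apply/eqP; rewrite -normr_le0 -[leRHS](@normr0 _ H) norm_iter_adjoint_le.
move=> a u v; rewrite !inE => -[n nP] [m mP]; exists (maxn n m) => p.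
rewrite geq_max => /andP[np mp].
by rewrite iter_adjoint_linear nP// mP// linearPl /= scalerDl scalerA.
Qed.

(* The powers of the adjoint of S i0 converge strongly to the projection onto
   the line through v0. *)
Lemma iter_adjoint_near x (e : R[i]) : closure (linear_span B) x -> 0 < e ->
  exists n : nat, `|dot x v0 *: v0 - iter n (A i0) x| < e.
Proof.
move=> /closure_normP clx e0.
have [s sB xs] := clx _ (divr_gt0 e0 (ltr0Sn _ 1)).
have [n nP] := iter_adjoint_span sB; exists n.
(* On [s] both terms agree by the choice of [n], and on [x - s] each has norm below [e / 2]. *)
have {1}-> : x = 1 *: (x - s) + s by rewrite scale1r subrK.
have {2}-> : x = 1 *: (x - s) + s by rewrite scale1r subrK.
rewrite linearPl /= iter_adjoint_linear nP// mul1r scale1r scalerDl opprD addrACA.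
rewrite subrr addr0 [ltRHS]splitr (le_lt_trans (ler_normB _ _))//.
rewrite ltrD ?(le_lt_trans (norm_iter_adjoint_le _ _ _))//.
by rewrite normrZ hv0 mulr1 (le_lt_trans (dot_CauchySchwarz hdot _ _))// hv0 mulr1.
Qed.

(** * Density of the span and irreducibility *)

Lemma span_dense_irreducible :
  closure (linear_span B) = setT -> irreducible_representation dot S.
Proof.
move=> dense K clK subK SK AK.
have AKk i k : K k -> K (A i k) by move=> Kk; apply: AK; exists k.
have [[k Kk kv0]|orth] := pselect (exists2 k, K k & dot k v0 != 0); [right|left].
  have Kv0 : K v0.
    suff : K (dot k v0 *: v0).
      by move/(submod_setZ (dot k v0)^-1 subK); rewrite scalerA mulVf ?scale1r.
    apply: clK; apply/closure_normP => e e0.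
    have [|n ne] := @iter_adjoint_near k e _ e0; first by rewrite dense.
    exists (iter n (A i0) k) => //.
    by elim: n {ne} => //= n; exact: AKk.
  apply/seteqP; split => // x _; apply: clK.
  have : closure (linear_span B) x by rewrite dense.
  apply: closure_subset; apply: linear_span_min => // _ [w _ <-].
  by elim: w => //= i w Kw; apply: SK; exists (W w).
apply/seteqP; split => [k Kk|_ ->]; last exact: submod_set0.
have spanK : linear_span B `<=` [set x | dot x k = 0].
  apply: linear_span_min => [|_ [w _ <-] /=].
    split; first by rewrite inE /= linear0l.
    by move=> a u v; rewrite !inE /= linearPl /= => -> ->; rewrite mulr0 addr0.
  (* Here [k] must vary: a letter moved across the form becomes an adjoint acting on [k], and the
     result stays in [K]. *)
  elim: w k Kk => [|i w IH] k Kk /=; last by rewrite dot_gen IH//; exact: AKk.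
  rewrite dot_conj; apply/eqP; rewrite fmorph_eq0; apply: contrapT => kv0.
  by apply: orth; exists k => //; apply/negP.
apply/eqP; rewrite -normr_eq0; apply: contrapT => /negP nk0.
have k0 : 0 < `|k| by rewrite lt_def nk0 normr_ge0.
(* Radius [|k|] suffices: as [s] is orthogonal to [k], Cauchy-Schwarz for [k - s] and [k] forces the
   distance to be at least [|k|]. *)
have /closure_normP/(_ _ k0)[s /spanK /= sk ks] : closure (linear_span B) k.
  by rewrite dense.
have := dot_CauchySchwarz hdot (k - s) k.
rewrite linearBl /= sk subr0 -hdot normrX normr_id expr2 ler_pM2r//.
by move=> /le_lt_trans/(_ ks); rewrite ltxx.
Qed.

Lemma irreducible_span_dense :
  irreducible_representation dot S -> closure (linear_span B) = setT.
Proof.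
move=> irr; have subB := linear_span_submod B.
have Bv0 : B v0 by exists [::].
case: (irr (closure (linear_span B))) => //.
- exact: closed_closure.
- exact: closure_submod.
- move=> i; apply: closure_contraction => [x y|x|_ [x Bx <-]].
  + by rewrite linearB.
  + by rewrite norm_gen.
  + have : [set x | linear_span B (S i x)] x; last by [].
    move: x Bx; apply: linear_span_min => [|_ [w _ <-]].
      split; first by rewrite inE /= linear0; exact: submod_set0.
      by move=> a u v; rewrite !inE /= linearP; exact: submod_setP.
    by apply: subset_linear_span; exists (i :: w).
- move=> i; apply: closure_contraction => [x y|x|_ [x Bx <-]].
  + exact: adjointB.
  + exact: norm_adjoint_le.
  + have : [set x | linear_span B (A i x)] x; last by [].
    move: x Bx; apply: linear_span_min => [|_ [w _ <-]].
      split.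
        rewrite inE /=; rewrite -[0](subrr 0) adjointB subrr; exact: submod_set0.
      by move=> a u v; rewrite !inE /= adjoint_linear; exact: submod_setP.
    (* The empty word is traded for the one-letter word [i0], so the adjoint always meets a
       letter. *)
    have [j [u ->]] : exists j u, W w = S j (W u).
      by case: w => [|j u]; [exists i0, [::]|exists j, u].
    rewrite /= adjoint_gen; apply: submod_setZ => //.
    by apply: subset_linear_span; exists u.
- move=> cl0; have : closure (linear_span B) v0.
    by apply: subset_closure; exact: subset_linear_span.
  by rewrite cl0 => v00; move/eqP: hv0; rewrite v00 normr0 eq_sym oner_eq0.
Qed.

End FixedVector.
End Cuntz.

Theorem theorem2p3 (R : realType) (H : completeNormedModType R[i])
    (dot : {dot H for Num.conj}) (hdot : induces_norm dot)
    (hsep : separable H)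
    (N : nat) (hN : (1 < N)%N) (S : 'I_N -> {linear H -> H})
    (hS : cuntz_representation dot S)
    (v0 : H) (hv0 : `|v0| = 1) (hfix : S (Ordinal (ltnW hN)) v0 = v0) :
  orthonormal_basis dot [set word_op S w v0 | w in [set: seq 'I_N]]
  <-> irreducible_representation dot S.
Proof.
split => [[_ dense]|irr].
  exact: (span_dense_irreducible hdot hS hv0 hfix dense).
split; first exact: (word_orthonormal hdot hS hv0 hfix).
exact: (irreducible_span_dense hdot hS hv0 hfix irr).
Qed.
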